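(* Let $t>0$, $\lambda>0$, $n\in\mathbb{N}$ and $\rho\in\mathbb{R}^d$ with $|\rho|=1$. For all $k,l\in\{1,\dots,n\}$ the covariance between two second-order spatial increments is given by $$\mathrm{Cov}(\mathbf{I}_{\mathrm{sp},k},\mathbf{I}_{\mathrm{sp},l})=\frac{8t\lambda^{2-\beta}}{(2\pi)^d\vartheta}\int_{\mathbb{R}^d}\cos((k-l)\rho\cdot\omega)\,g_{\mathrm{sp},\lambda}(\omega)\,d\omega,$$ where $$g_{\mathrm{sp},\lambda}(\omega)=\big(1-\mathrm{sinc}(2t\sqrt\vartheta\lambda^{-1}|\omega|)\big)\sin^4(\rho\cdot\omega/2)\,|\omega|^{\beta-d-2}.$$
   Context: Let $d\in\mathbb{N}$, $\beta\in(0,\min(2,d))$ and $\vartheta>0$. $u=(u(t,x))_{t\ge0,x\in\mathbb{R}^d}$ denotes the solution of the stochastic wave equation $\partial_{tt}^2u=\vartheta\Delta u+\dot W_\beta$ on $\mathbb{R}^d$ with $u(0,\cdot)=\partial_tu(0,\cdot)\equiv0$, driven by centred Gaussian noise that is white in time and has Riesz-kernel spatial covariance (proportional to $|x-y|^{-\beta}$) with spectral density $|\xi|^{\beta-d}$. That is, $u$ is the centred Gaussian process with covariance $$\mathbb{E}[u(t,x)u(s,y)]=\frac{1}{(2\pi)^d}\int_0^{t\wedge s}\int_{\mathbb{R}^d}e^{\mathrm{i}(x-y)\cdot\xi}\,\frac{\sin((t-r)\sqrt\vartheta|\xi|)}{\sqrt\vartheta|\xi|}\,\frac{\sin((s-r)\sqrt\vartheta|\xi|)}{\sqrt\vartheta|\xi|}\,|\xi|^{\beta-d}\,d\xi\,dr.$$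 Observation points: $x_k=\lambda k\rho$, $k=0,\dots,n+1$. The second-order spatial increments are $\mathbf{I}_{\mathrm{sp},k}=u(t,x_{k+1})+u(t,x_{k-1})-2u(t,x_k)$, $k=1,\dots,n$. Here $\mathrm{sinc}(x)=\sin(x)/x$. *)

(* Defs.v *)
From HB Require Import structures.
From mathcomp Require Import all_boot all_order all_algebra.
From mathcomp Require Import all_classical all_reals all_analysis.
From mathcomp Require Import complex.

Set Implicit Arguments.
Unset Strict Implicit.
Unset Printing Implicit Defensive.

Import Order.TTheory GRing.Theory Num.Theory.
Import numFieldNormedType.Exports.

Local Open Scope classical_set_scope.
Local Open Scope ring_scope.

(* Measurable structure on row vectors: the sigma-algebra generated by the
   coordinate maps, as the library does for tuples. *)
Definition measure_rV_display : measure_display -> measure_display.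
Proof. exact. Qed.

Section measurable_rV.
Context {d} {T : sigmaRingType d}.
Variable n : nat.

Let coors : 'I_n -> 'rV[T]_n -> T := fun i v => v ord0 i.

Let rV_set0 : g_sigma_preimage coors set0.
Proof. exact: sigma_algebra0. Qed.

Let rV_setC A : g_sigma_preimage coors A -> g_sigma_preimage coors (~` A).
Proof. exact: sigma_algebraC. Qed.

Let rV_bigcup (F : _^nat) : (forall i, g_sigma_preimage coors (F i)) ->
  g_sigma_preimage coors (\bigcup_i (F i)).
Proof. exact: sigma_algebra_bigcup. Qed.

HB.instance Definition _ := @isMeasurable.Build (measure_rV_display d)
  'rV[T]_n (g_sigma_preimage coors) rV_set0 rV_setC rV_bigcup.

End measurable_rV.

Section measurable_rV_lemmas.
Context d (T : measurableType d).

Lemma measurable_rV_coord n (i : 'I_n) :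
  measurable_fun [set: 'rV[T]_n] (fun v : 'rV[T]_n => v ord0 i).
Proof.
move=> _ Y mY; rewrite setTI; apply: sub_sigma_algebra => /=.
rewrite -bigcup_seq/=; exists i => /=; first by rewrite mem_index_enum.
by exists Y => //; rewrite setTI.
Qed.

Lemma measurable_fun_rVP d1 (T1 : measurableType d1) n (f : T1 -> 'rV[T]_n) :
  (forall i, measurable_fun [set: T1] (fun x => f x ord0 i)) ->
  measurable_fun [set: T1] f.
Proof.
move=> mf; apply: (@measurability _ _ _ _ _ _
  (\big[setU/set0]_(i < n)
     preimage_set_system setT (fun v : 'rV[T]_n => v ord0 i) measurable)) => //.
move=> _ [A + <-]; rewrite -bigcup_seq => -[i _ [B mB <-]].
by rewrite (setTI (_ @^-1` B)) -comp_preimage; exact: mf.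
Qed.

End measurable_rV_lemmas.

Section sigma_finite_measure_of.
Context d (T : measurableType d) (R : realType).
Variables (mu : {measure set T -> \bar R}) (sf : sigma_finite setT mu).

Let alias of sigma_finite setT mu : set T -> \bar R := mu.
HB.instance Definition _ := Measure.on (alias sf).
HB.instance Definition _ := Measure_isSigmaFinite.Build _ _ _ (alias sf) sf.

Lemma sigma_finite_measure_of :
  {m : {sigma_finite_measure set T -> \bar R} | m = mu :> (set _ -> \bar R)}.
Proof. by exists [the sigma_finite_measure _ _ of alias sf]. Qed.

End sigma_finite_measure_of.

Section sigma_finite_helpers.
Context d1 d2 (T1 : measurableType d1) (T2 : measurableType d2) (R : realType).

Lemma product_sigma_finite_measure
    (m1 : {sigma_finite_measure set T1 -> \bar R})
    (m2 : {sigma_finite_measure set T2 -> \bar R}) :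
  {m : {sigma_finite_measure set (T1 * T2)%type -> \bar R} |
    m = (m1 \x m2)%E :> (set _ -> \bar R)}.
Proof.
pose mu : {measure set (T1 * T2)%type -> \bar R} :=
  [the measure _ _ of (m1 \x m2)%E].
have sf : sigma_finite setT mu.
  have /sigma_finiteP[F [TF ndF Foo]] := sigma_finiteT m1.
  have /sigma_finiteP[G [TG ndG Goo]] := sigma_finiteT m2.
  exists (fun n => F n `*` G n).
    rewrite -setXTT TF TG predeqE => -[x y]; split.
      move=> [/= [n _ Fnx] [k _ Gky]]; exists (maxn n k) => //; split.
      - by move: x Fnx; exact/subsetPset/ndF/leq_maxl.
      - by move: y Gky; exact/subsetPset/ndG/leq_maxr.
    by move=> [n _ []/= ? ?]; split; exists n.
  move=> k; have [? ?] := Foo k; have [? ?] := Goo k.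
  split; first exact: measurableX.
  by rewrite /mu/= product_measure1E// lte_mul_pinfty// ge0_fin_numE.
exact: sigma_finite_measure_of sf.
Qed.

Lemma pushforward_bij_sigma_finite_measure (m0 : set T1 -> \bar R)
    (f : T1 -> T2) (g : T2 -> T1) :
  {m : {sigma_finite_measure set T1 -> \bar R} | m = m0 :> (set _ -> \bar R)} ->
  measurable_fun setT f -> measurable_fun setT g -> cancel f g ->
  {m : {sigma_finite_measure set T2 -> \bar R} |
    m = pushforward m0 f :> (set _ -> \bar R)}.
Proof.
move=> [m <-] mf mg fK.
pose mu : {measure set T2 -> \bar R} :=
  measure_function_pushforward__canonical__measure_function_Measure m mf.
have sf : sigma_finite setT mu.
  have [F FT Foo] := sigma_finiteT m.
  exists (fun k => g @^-1` F k).
    by rewrite -preimage_bigcup -FT preimage_setT.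
  move=> k; have [mF Fk] := Foo k; split.
    by rewrite -[X in measurable X]setTI; exact: mg.
  rewrite /mu /= /pushforward -comp_preimage.
  by rewrite (_ : g \o f = id)//; apply/funext => x /=; rewrite fK.
exact: sigma_finite_measure_of sf.
Qed.

End sigma_finite_helpers.

(* Lebesgue measure on 'rV[R]_n, as the n-fold product of the
   one-dimensional Lebesgue measure. *)
Definition cons_rV (R : realType) n (p : R * 'rV[R]_n) : 'rV[R]_n.+1 :=
  row_mx (\row_(_ < 1) p.1) p.2.

Fixpoint lebesgue_rV (R : realType) n : set 'rV[R]_n -> \bar R :=
  match n with
  | 0 => \d_ (0 : 'rV[R]_0)
  | n'.+1 => pushforward (lebesgue_measure \x @lebesgue_rV R n')%E
                         (@cons_rV R n')
  end.

Section lebesgue_rV.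
Context {R : realType}.

Lemma cons_rV0 n (p : R * 'rV[R]_n) : cons_rV p ord0 ord0 = p.1.
Proof.
rewrite /cons_rV.
have -> : ord0 = lshift n (ord0 : 'I_1) :> 'I_n.+1 by exact/val_inj.
by apply: etrans (row_mxEl _ p.2 ord0 ord0) _; rewrite mxE.
Qed.

Lemma cons_rVS n (p : R * 'rV[R]_n) (i : 'I_n) :
  cons_rV p ord0 (lift ord0 i) = p.2 ord0 i.
Proof.
rewrite /cons_rV.
have -> : lift ord0 i = rshift 1 i :> 'I_n.+1 by exact/val_inj.
exact: (row_mxEr (\row__ p.1)).
Qed.

Lemma measurable_cons_rV n :
  measurable_fun [set: R * 'rV[R]_n] (@cons_rV R n).
Proof.
apply: measurable_fun_rVP => i; case: (unliftP ord0 i) => [j|] ->.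
- rewrite (_ : (fun _ => _) = (fun v : 'rV[R]_n => v ord0 j) \o snd).
    by apply: measurableT_comp => //; exact: measurable_rV_coord.
  by apply/funext => p /=; rewrite cons_rVS.
- rewrite (_ : (fun _ => _) = fst) //.
  by apply/funext => p; rewrite cons_rV0.
Qed.

Lemma measurable_uncons_rV n :
  measurable_fun [set: 'rV[R]_n.+1]
    (fun v : 'rV[R]_n.+1 => (v ord0 ord0, \row_(i < n) v ord0 (lift ord0 i))).
Proof.
apply/measurable_fun_pairP; split; first exact: measurable_rV_coord.
apply: measurable_fun_rVP => i.
rewrite (_ : (fun _ => _) = fun v : 'rV[R]_n.+1 => v ord0 (lift ord0 i)).
  exact: measurable_rV_coord.
by apply/funext => v; rewrite mxE.
Qed.

Lemma cons_rVK n : cancel (@cons_rV R n)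
  (fun v : 'rV[R]_n.+1 => (v ord0 ord0, \row_(i < n) v ord0 (lift ord0 i))).
Proof.
move=> [x v]; rewrite cons_rV0; congr pair.
by apply/rowP => i; rewrite mxE cons_rVS.
Qed.

Lemma uncons_rVK n : cancel
  (fun v : 'rV[R]_n.+1 => (v ord0 ord0, \row_(i < n) v ord0 (lift ord0 i)))
  (@cons_rV R n).
Proof.
move=> v; apply/rowP => i; case: (unliftP ord0 i) => [j|] ->.
- by rewrite cons_rVS mxE.
- by rewrite cons_rV0.
Qed.

Let lebesgue_rVP n :
  {m : {sigma_finite_measure set 'rV[R]_n -> \bar R} |
    m = @lebesgue_rV R n :> (set _ -> \bar R)}.
Proof.
elim: n => [|n [m mE]] /=; first by exists [the sigma_finite_measure _ R of
  \d_ (0 : 'rV[R]_0)].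
rewrite -mE.
exact: (pushforward_bij_sigma_finite_measure
  (product_sigma_finite_measure lebesgue_measure m)
  (@measurable_cons_rV n) (@measurable_uncons_rV n) (@cons_rVK n)).
Qed.

Let lebesgue_rV_set0 n : @lebesgue_rV R n set0 = 0%E.
Proof. by have [m <-] := lebesgue_rVP n; exact: measure0. Qed.

Let lebesgue_rV_ge0 n A : (0 <= @lebesgue_rV R n A)%E.
Proof. by have [m <-] := lebesgue_rVP n; exact: measure_ge0. Qed.

Let lebesgue_rV_sigma_additive n : semi_sigma_additive (@lebesgue_rV R n).
Proof.
by have [m <-] := lebesgue_rVP n; exact: measure_semi_sigma_additive.
Qed.

HB.instance Definition _ n := isMeasure.Build _ _ _ (@lebesgue_rV R n)
  (lebesgue_rV_set0 n) (@lebesgue_rV_ge0 n) (@lebesgue_rV_sigma_additive n).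

Let lebesgue_rV_sigma_finite n : sigma_finite setT (@lebesgue_rV R n).
Proof. by have [m <-] := lebesgue_rVP n; exact: sigma_finiteT. Qed.

HB.instance Definition _ n := Measure_isSigmaFinite.Build _ _ _
  (@lebesgue_rV R n) (lebesgue_rV_sigma_finite n).

Lemma measurable_box_rV n (A : 'I_n -> set R) :
  (forall i, measurable (A i)) ->
  measurable [set v : 'rV[R]_n | forall i, A i (v ord0 i)].
Proof.
move=> mA; rewrite (_ : [set _ | _] =
    \bigcap_(i in [set: 'I_n]) ((fun v : 'rV[R]_n => v ord0 i) @^-1` A i)).
  apply: fin_bigcap_measurable => // i _; rewrite -[X in measurable X]setTI.
  exact: measurable_rV_coord.
by apply/seteqP; split=> v /= Av i; [move=> _|]; exact: Av.
Qed.

Lemma lebesgue_rV_box n (A : 'I_n -> set R) : (forall i, measurable (A i)) ->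
  lebesgue_rV [set v : 'rV[R]_n | forall i, A i (v ord0 i)] =
  (\prod_(i < n) lebesgue_measure (A i))%E.
Proof.
elim: n => [|n IHn] in A *.
  by move=> _; rewrite big_ord0 /= diracE mem_set//; case.
move=> mA; rewrite big_ord_recl /= -IHn//.
have mB : measurable [set v : 'rV[R]_n | forall i, A (lift ord0 i) (v ord0 i)].
  exact: (measurable_box_rV (fun i => mA (lift ord0 i))).
apply: etrans (product_measure1E lebesgue_measure (@lebesgue_rV R n)
  (mA ord0) mB).
rewrite /pushforward; congr (product_measure1 _ _).
apply/seteqP; split=> -[x v] /=.
  move=> Av; split; first by have := Av ord0; rewrite cons_rV0.
  by move=> i; have := Av (lift ord0 i); rewrite cons_rVS.
move=> [Ax Av] i; case: (unliftP ord0 i) => [j|] ->.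
  by rewrite cons_rVS; exact: Av.
by rewrite cons_rV0.
Qed.

End lebesgue_rV.

Section euclidean.
Context {R : realType}.

Definition dot n (x y : 'rV[R]_n) : R := \sum_(i < n) x ord0 i * y ord0 i.

(* The norm that the library puts on 'rV[R]_n is the sup norm. *)
Definition enorm n (x : 'rV[R]_n) : R := Num.sqrt (dot x x).

Definition sinc (x : R) : R := if x == 0 then 1 else sin x / x.

End euclidean.

Section complex_integral.
Local Open Scope complex_scope.

Definition expi {R : realType} (x : R) : R[i] := cos x +i* sin x.

Definition Cintegral {d} {T : measurableType d} {R : realType}
    (mu : {measure set T -> \bar R}) (D : set T) (f : T -> R[i]) : R[i] :=
  Rintegral mu D (fun x => complex.Re (f x)) +i*
  Rintegral mu D (fun x => complex.Im (f x)).

End complex_integral.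

Section gaussian.
Context {disp : measure_display} {T : measurableType disp} {R : realType}.
Variable P : probability T R.

(* A normal law N(m, s^2), with N(m, 0) the Dirac mass at m; the case s = 0 is
   apart because normal_prob m 0 is not a Dirac mass. *)
Definition is_normal (X : T -> R) : Prop :=
  exists m s : R, forall A : set R, measurable A ->
    P (X @^-1` A) = if s == 0 then \d_m A else normal_prob m s A.

Definition gaussian_process {I : Type} (J : set I) (X : I -> T -> R) : Prop :=
  forall (k : nat) (i : 'I_k -> I) (c : 'I_k -> R), (forall j, J (i j)) ->
    is_normal (fun w => \sum_(j < k) c j * X (i j) w).

End gaussian.

Section wave_equation.
Context {disp : measure_display} {T : measurableType disp} {R : realType}.
Variable P : probability T R.
Variables (d : nat) (beta theta : R).
Local Open Scope complex_scope.

(* At xi = 0, a null set, the integrand takes the conventional values of x / 0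
   and of 0 `^ a. *)
Definition wave_cov (t : R) (x : 'rV[R]_d) (s : R) (y : 'rV[R]_d) : R[i] :=
  (((2 * pi) ^+ d)^-1)%:C *
  Cintegral lebesgue_measure `[0, Num.min t s] (fun r : R =>
    Cintegral (@lebesgue_rV R d) setT (fun xi =>
      expi (dot (x - y) xi) *
      (sin ((t - r) * Num.sqrt theta * enorm xi) /
        (Num.sqrt theta * enorm xi))%:C *
      (sin ((s - r) * Num.sqrt theta * enorm xi) /
        (Num.sqrt theta * enorm xi))%:C *
      (enorm xi `^ (beta - d%:R))%:C)).

(* The solution with zero initial data, through its law: the centred Gaussian
   process on t >= 0, x in R^d with covariance function wave_cov. Values at
   negative times are unconstrained. *)
Definition wave_solution (u : R -> 'rV[R]_d -> {RV P >-> R}) : Prop :=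
  [/\ gaussian_process P [set tx : R * 'rV[R]_d | 0 <= tx.1]
        (fun tx => u tx.1 tx.2),
      forall t x, 0 <= t -> ('E_P[u t x] = 0)%E &
      forall t x s y, 0 <= t -> 0 <= s ->
        exists2 c : R, ('E_P[(fun w => u t x w * u s y w)%R] = c%:E)%E &
                       c%:C = wave_cov t x s y].

(* Only meaningful for k >= 1. *)
Definition sp_incr (u : R -> 'rV[R]_d -> {RV P >-> R}) (t lambda : R)
    (rho : 'rV[R]_d) (k : nat) : T -> R :=
  let x (j : nat) := (lambda * j%:R) *: rho in
  fun w => u t (x k.+1) w + u t (x k.-1) w - 2 * u t (x k) w.

Definition g_sp (t lambda : R) (rho w : 'rV[R]_d) : R :=
  (1 - sinc (2 * t * Num.sqrt theta * lambda^-1 * enorm w)) *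
  sin (dot rho w / 2) ^+ 4 * enorm w `^ (beta - d%:R - 2).

End wave_equation.

(* Main.v *)
(* Idea. Everything reduces to spectral integrals over R^d. The density
   |xi|^(beta - d) min(1, |xi|^-2) is the d-th power of a decreasing function
   phi(|xi|), hence is dominated by the product of the phi(|xi_i|), so that its
   integrability follows from that of phi on the line. Fubini's theorem then
   lets the time integral of sin^2((t - r) q) be computed first, giving
   t/2 (1 - sinc(2 t q)). Taking a second difference in space multiplies
   cos(dot(x - y) xi) by -4 sin^2(h / 2), with h = lambda rho . xi; doing so in
   both variables gives 16 sin^4(h / 2), and the substitution w = lambda xi
   yields the formula. *)

Require Import Defs.
From mathcomp Require Import all_boot all_order all_algebra.
From mathcomp Require Import all_classical all_reals all_analysis.
From mathcomp Require Import complex measurable_realfun ring lra.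
Import Order.TTheory GRing.Theory Num.Theory.
Import numFieldNormedType.Exports.
Local Open Scope classical_set_scope.
Local Open Scope ring_scope.


(** * Integrals of powers on the half-line and a profile integrable on the line *)

Lemma within_continuous_derivable (R : realType) (f : R -> R) (a b : R) :
  (forall x, x \in `[a, b] -> derivable f x 1) -> {within `[a, b], continuous f}.
Proof.
move=> df; apply: continuous_in_subspaceT => x /set_mem/df dfx.
exact/differentiable_continuous/derivable1_diffP.
Qed.

(** The exponent is written [c - 1] because the antiderivative is [c^-1 * x ^ c]. The sign of [c] is
    left free: positive for the bound near 0, negative for the bound near infinity. *)
Lemma integral_powR (R : realType) (c p q : R) : 0 < p -> p < q -> c != 0 ->
  (\int[lebesgue_measure]_(x in `[p, q]) (x `^ (c - 1))%:E =
   ((q `^ c - p `^ c) / c)%:E)%E.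
Proof.
move=> p0 pq c0.
have gt0 x : x \in `[p, q] -> 0 < x.
  by rewrite in_itv /= => /andP[/(lt_le_trans p0)].
have dF (x : R) : 0 < x ->
    is_derive x 1 (fun y : R => c^-1 * y `^ c : R) (x `^ (c - 1) : R).
  move=> x0; have dc := is_derive1_powR c x0.
  have := is_deriveZ c^-1 dc.
  by rewrite /GRing.scale /= mulrA mulVf // mul1r.
rewrite (continuous_FTC2 (F := fun y => c^-1 * y `^ c)) //.
- by rewrite -EFinB; congr EFin; rewrite mulrBl ![_ / c]mulrC.
- apply: within_continuous_derivable => x /gt0 x0.
  by apply: derivable_powR; rewrite in_itv /= x0.
- have cont x : 0 < x -> {for x, continuous (fun y : R => c^-1 * y `^ c)}.
    move=> /dF[+ _] => /derivable1_diffP; exact: differentiable_continuous.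
  split.
  + by move=> x; rewrite in_itv /= => /andP[px _]; have [] := dF x (lt_trans p0 px).
  + exact/cvg_at_right_filter/cont.
  + exact/cvg_at_left_filter/cont/(lt_trans p0).
- move=> x; rewrite in_itv /= => /andP[px _]; rewrite derive1E.
  by have [] := dF x (lt_trans p0 px).
Qed.

(** Overlaps are allowed so that the two intervals in the next integral estimate may share the
    endpoint 1. *)
Lemma ge0_integral_setU_le d (T : measurableType d) (R : realType)
    (mu : {measure set T -> \bar R}) (A B : set T) (f : T -> \bar R) :
  measurable A -> measurable B -> measurable_fun setT f ->
  (forall x, 0 <= f x)%E ->
  (\int[mu]_(x in A `|` B) f x <= \int[mu]_(x in A) f x + \int[mu]_(x in B) f x)%E.
Proof.
move=> mA mB mf f0.
rewrite -[A `|` B]setD0 -(setDv A) -setUDr ge0_integral_setU //.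
- apply: leeD => //; apply: ge0_subset_integral => //.
  + exact: measurableD.
  + exact: (measurable_funTS mf).
- exact: measurableD.
- exact: (measurable_funTS mf).
- by apply/disj_setPS => x [Ax [_ /(_ Ax)]].
Qed.

(** For [a = beta / d] and [b = (2 - beta) / d], the [d]-th power of this profile at [x > 0] is
    [x ^ (beta - d) * min(1, x ^ -2)], the shape of the integrable majorant of the wave kernel. *)
Definition power_profile {R : realType} (a b x : R) : R :=
  Num.min (x `^ (a - 1)) (x `^ (- b - 1)).

Lemma power_profile_ge0 (R : realType) (a b x : R) : 0 <= power_profile a b x.
Proof. by rewrite /power_profile le_min !powR_ge0. Qed.

Lemma measurable_power_profile (R : realType) (a b : R) :
  measurable_fun setT (power_profile a b).
Proof. by apply: measurable_minr; exact: measurable_powR. Qed.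

(** The first power is integrable up to 1, with integral at most [a^-1], and the second from 1 on,
    with integral at most [b^-1]. Both bounds are uniform over compact intervals exhausting the open
    half-line, and evenness gives the other half. *)
Lemma integral_power_profile_lty (R : realType) (a b : R) : 0 < a -> 0 < b ->
  (\int[lebesgue_measure]_x (power_profile a b `|x|)%:E < +oo)%E.
Proof.
move=> a0 b0; pose f (x : R) := (power_profile a b `|x|)%:E.
have f0 x : (0 <= f x)%E by rewrite lee_fin power_profile_ge0.
have mf : measurable_fun [set: R] f.
  apply/measurable_EFinP; apply: measurableT_comp => //.
  exact: measurable_power_profile.
have fN x : f (- x) = f x by rewrite /f normrN.
have half : (\int[lebesgue_measure]_(x in `[0%R, +oo[) f x < +oo)%E.
  rewrite -integral_itv_obnd_cbnd; last exact: (measurable_funTS mf).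
  (* With right end [n.+2] the interval from 1 is nondegenerate even at [n = 0], as [integral_powR]
     requires; the interval up to 1 is then a single point, treated apart. *)
  pose F (n : nat) := `[(n.+1%:R)^-1, n.+2%:R : R]%classic.
  have FE : `]0, +oo[%classic = \bigcup_n F n.
    apply/seteqP; split => [x|x [n _]]; rewrite /F /= !in_itv /=; last first.
      move=> /andP[+ _]; rewrite andbT; apply: lt_le_trans.
      by rewrite invr_gt0.
    rewrite andbT => x0.
    (* Since [y < (Num.truncn y).+1], this [n] serves both ends of the interval. *)
    pose n := maxn (Num.truncn x^-1) (Num.truncn x).
    exists n => //=; rewrite in_itv /=; apply/andP; split.
      rewrite -[leRHS]invrK lef_pV2 ?posrE ?invr_gt0 //.
      apply/ltW/(lt_le_trans (truncnS_gt _)); rewrite ler_nat ltnS leq_maxl //.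
    apply/ltW/(lt_le_trans (truncnS_gt _)); rewrite ler_nat ltnS.
    by rewrite (leq_trans (leq_maxr _ _) (leqnSn _)).
  rewrite FE.
  have nd : nondecreasing_seq F.
    move=> m n mn; apply/subsetPset => x; rewrite /F /= !in_itv /= => /andP[h1 h2].
    apply/andP; split.
      by rewrite (le_trans _ h1) // lef_pV2 ?posrE ?ler_nat.
    by rewrite (le_trans h2) // ler_nat !ltnS.
  have cv : (\int[lebesgue_measure]_(x in F i) f x @[i --> \oo] -->
      \int[lebesgue_measure]_(x in \bigcup_i F i) f x)%E.
    apply: ge0_nondecreasing_set_cvg_integral => //.
    - by move=> i; exact: measurable_itv.
    - by move=> i; exact: (measurable_funTS mf).
  apply: (@le_lt_trans _ _ (a^-1 + b^-1)%:E); last by rewrite ltry.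
  have -> : (\int[lebesgue_measure]_(x in \bigcup_i F i) f x =
     limn (fun i => \int[lebesgue_measure]_(x in F i) f x))%E by apply/esym/cvg_lim.
  apply: lime_le; first by apply/cvg_ex; eexists; exact: cv.
  apply: nearW => n.
  have sub : F n `<=` `[n.+1%:R^-1, 1] `|` `[1, n.+2%:R].
    move=> x; rewrite /F /= !in_itv /= => /andP[-> ->].
    by have /orP[->|->] := le_total x 1; [left|rewrite andbT; right].
  have n1 : (n.+1%:R : R)^-1 <= 1 by rewrite invf_le1 // ler1n.
  have n2 : (1 : R) < n.+2%:R by rewrite ltr1n.
  have split1 :
      (\int[lebesgue_measure]_(x in `[(n.+1%:R^-1)%R : R, 1%R]) f x <= (a^-1)%:E)%E.
    move: n1; rewrite le_eqVlt => /predU1P[->|n1].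
      by rewrite set_itv1 integral_set1 lee_fin invr_ge0 ltW.
    apply: (@le_trans _ _ (\int[lebesgue_measure]_(x in `[(n.+1%:R^-1)%R : R, 1%R])
       (x `^ (a - 1))%:E)%E).
      apply: ge0_le_integral => //.
      + exact: (measurable_funTS mf).
      + apply/measurable_EFinP; apply: measurable_funTS; exact: measurable_powR.
      + move=> x /=; rewrite in_itv /= => /andP[h _]; rewrite lee_fin.
        rewrite ger0_norm; last by rewrite (le_trans _ h) // invr_ge0.
        by rewrite /power_profile ge_min lexx.
    rewrite integral_powR ?invr_gt0 //; last by rewrite gt_eqF.
    rewrite lee_fin powR1 mulrBl mul1r gerBl mulr_ge0 ?powR_ge0 //.
    by rewrite invr_ge0 ltW.
  have split2 :
      (\int[lebesgue_measure]_(x in `[1%R, n.+2%:R%R : R]) f x <= (b^-1)%:E)%E.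
    apply: (@le_trans _ _ (\int[lebesgue_measure]_(x in `[1%R, n.+2%:R%R])
       (x `^ (- b - 1))%:E)%E).
      apply: ge0_le_integral => //.
      + exact: (measurable_funTS mf).
      + apply/measurable_EFinP; apply: measurable_funTS; exact: measurable_powR.
      + move=> x /=; rewrite in_itv /= => /andP[h _]; rewrite lee_fin.
        rewrite ger0_norm; last by rewrite (le_trans _ h).
        by rewrite /power_profile ge_min lexx orbT.
    rewrite integral_powR //; last by rewrite oppr_eq0 gt_eqF.
    rewrite lee_fin powR1 invrN mulrN mulrBl opprB mul1r gerBl.
    by rewrite mulr_ge0 ?powR_ge0 // invr_ge0 ltW.
  apply: (@le_trans _ _ (\int[lebesgue_measure]_(x in
      `[(n.+1%:R^-1)%R : R, 1%R] `|` `[1%R, n.+2%:R%R : R]) f x)%E).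
    apply: ge0_subset_integral => //.
    - exact: measurable_itv.
    - by apply: measurableU; exact: measurable_itv.
    - exact: (measurable_funTS mf).
  rewrite EFinD; apply: (le_trans _ (leeD split1 split2)).
  by apply: ge0_integral_setU_le => //; exact: measurable_itv.
rewrite -(itv_setU_setT true 0).
apply: (le_lt_trans (ge0_integral_setU_le _ _ _ _ _ _ _ _ _ _ _)) => //.
rewrite lte_add_pinfty //.
rewrite integral_itv_bndo_bndc; last exact: (measurable_funTS mf).
rewrite [ltLHS](_ : _ = \int[lebesgue_measure]_(x in `]-oo, 0%R]) f (- x)%R)%E.
  by rewrite -ge0_integration_by_substitution0.
by apply: eq_integral => x _; rewrite fN.
Qed.

(** * Integration over R^n: iterated integrals, products and scaling *)

(** One step of the recursion defining [lebesgue_rV]: change of variables for the pushforward, then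
    Tonelli for the product measure. *)
Lemma ge0_integral_rV_cons (R : realType) n (G : 'rV[R]_n.+1 -> \bar R) :
  measurable_fun setT G -> (forall v, 0 <= G v)%E ->
  (\int[@lebesgue_rV R n.+1]_v G v =
   \int[lebesgue_measure]_x \int[@lebesgue_rV R n]_v G (cons_rV (x, v)))%E.
Proof.
move=> mG G0.
have E := @ge0_integral_pushforward _ _ (measurableTypeR R * 'rV[R]_n)%type
  'rV[R]_n.+1 R (@cons_rV R n)
  (@measurable_cons_rV R n) (lebesgue_measure \x @lebesgue_rV R n)%E setT G
  measurableT mG (fun v _ => G0 v).
apply: (etrans E).
rewrite preimage_setT fubini_tonelli1 //; last by move=> p; exact: G0.
by apply: measurableT_comp => //; exact: measurable_cons_rV.
Qed.

Lemma measurable_cons_rVr (R : realType) n (x : R) :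
  measurable_fun setT (fun v : 'rV[R]_n => cons_rV (x, v)).
Proof. by apply: measurableT_comp; [exact: measurable_cons_rV|]. Qed.

Lemma ge0_integral_rV_prod (R : realType) n (f : R -> R) :
  measurable_fun setT f -> (forall x, 0 <= f x) ->
  (\int[@lebesgue_rV R n]_v (\prod_(i < n) f (v ord0 i))%:E =
   \prod_(i < n) \int[lebesgue_measure]_x (f x)%:E)%E.
Proof.
move=> mf f0; elim: n => [|n IHn].
  rewrite [LHS]integral_dirac //; last first.
    by under eq_fun do rewrite big_ord0; exact: measurable_cst.
  by rewrite !big_ord0 diracE mem_set // mul1e.
have mp m : measurable_fun setT (fun v : 'rV[R]_m => \prod_(i < m) f (v ord0 i)).
  apply: measurable_prod => i _; apply: measurableT_comp => //.
  exact: measurable_rV_coord.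
rewrite ge0_integral_rV_cons; last 2 first.
- by apply/measurable_EFinP; exact: mp.
- by move=> v; rewrite lee_fin; apply: prodr_ge0 => *; exact: f0.
have E x v : ((\prod_(i < n.+1) f (cons_rV (x, v) ord0 i))%:E =
   (f x)%:E * (\prod_(i < n) f (v ord0 i))%:E)%E.
  rewrite -EFinM big_ord_recl cons_rV0; congr (_ * _)%:E.
  by apply: eq_bigr => i _; rewrite cons_rVS.
under eq_integral do under eq_integral do rewrite E.
rewrite [RHS]big_ord_recl -IHn -ge0_integralZr //; last 3 first.
- exact/measurable_EFinP.
- by move=> x _; rewrite lee_fin.
- by apply: integral_ge0 => v _; rewrite lee_fin; apply: prodr_ge0.
apply: eq_integral => x _; rewrite ge0_integralZl ?lee_fin //.
- by apply/measurable_EFinP; exact: mp.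
- by move=> v _; rewrite lee_fin; apply: prodr_ge0 => *; exact: f0.
Qed.

(** The pushforward of Lebesgue measure under multiplication by [c], itself multiplied by [c], gives
    each interval []a, b]] its length. By uniqueness it is Lebesgue measure. *)
Lemma ge0_integral_scale1 (R : realType) (c : R) (f : R -> \bar R) : 0 < c ->
  measurable_fun setT f -> (forall x, 0 <= f x)%E ->
  (\int[lebesgue_measure]_x f (c * x)%R =
   c^-1%:E * \int[lebesgue_measure]_x f x)%E.
Proof.
move=> c0 mf f0.
pose h : R -> measurableTypeR R := fun x => (c * x)%R.
have mh : measurable_fun setT h by exact: mulrl_measurable.
pose c' := NngNum (ltW c0).
suff E : (\int[lebesgue_measure]_x f x =
    c%:E * \int[lebesgue_measure]_x f (c * x)%R)%E.
  by rewrite E muleA -EFinM mulVf ?gt_eqF // mul1e.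
pose pm : {measure set (measurableTypeR R) -> \bar R} :=
  measure_function_pushforward__canonical__measure_function_Measure
    (lebesgue_measure : {measure set (measurableTypeR R) -> \bar R}) mh.
transitivity (\int[mscale c' pm]_x f x)%E.
  apply: eq_measure_integral => A mA _.
  apply: lebesgue_measure_unique => // _ [[a b]] _ <-.
  rewrite -[RHS]/(c%:E * lebesgue_measure (h @^-1` `]a, b]))%E.
  have -> : h @^-1` `]a, b] = `]c^-1 * a, c^-1 * b]%classic.
    apply/seteqP; split => x /=; rewrite /h !in_itv /= !ltr_pdivrMl // !ler_pdivlMl //.
  rewrite !lebesgue_measure_itv /= !lte_fin ltr_pM2l ?invr_gt0 //.
  case: ifP => _; last by rewrite mule0.
  by rewrite -EFinB -EFinM; congr EFin; rewrite -mulrBr mulrA divff ?mul1r ?gt_eqF.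
rewrite ge0_integral_mscale //.
congr (_ * _)%E.
exact: (@ge0_integral_pushforward _ _ (measurableTypeR R) (measurableTypeR R) R
  h mh lebesgue_measure setT f measurableT mf (fun x _ => f0 x)).
Qed.

Lemma scale_cons_rV (R : realType) n (c x : R) (v : 'rV[R]_n) :
  c *: cons_rV (x, v) = cons_rV (c * x, c *: v).
Proof.
apply/rowP => i; rewrite mxE; case: (unliftP ord0 i) => [j|] ->.
- by rewrite !cons_rVS mxE.
- by rewrite !cons_rV0.
Qed.

Lemma measurable_scale_rV (R : realType) n (c : R) :
  measurable_fun setT (fun v : 'rV[R]_n => c *: v).
Proof.
apply: measurable_fun_rVP => i; under eq_fun do rewrite mxE.
by apply: measurable_funM => //; exact: measurable_rV_coord.
Qed.

(** Induction on the dimension: scaling commutes with [cons_rV], and each coordinate contributes one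
    factor [c^-1]. *)
Lemma ge0_integral_rV_scale (R : realType) n (c : R) (G : 'rV[R]_n -> \bar R) :
  0 < c -> measurable_fun setT G -> (forall v, 0 <= G v)%E ->
  (\int[@lebesgue_rV R n]_v G (c *: v) =
   (c^-1 ^+ n)%:E * \int[@lebesgue_rV R n]_v G v)%E.
Proof.
move=> c0; elim: n => [|n IHn] in G * => mG G0.
  rewrite expr0 mul1e; apply: eq_integral => v _; congr G.
  by apply/rowP; case.
have mGc m (H : 'rV[R]_m -> \bar R) : measurable_fun setT H ->
    measurable_fun setT (fun v : 'rV[R]_m => H (c *: v)).
  by move=> mH; apply: measurableT_comp => //; exact: measurable_scale_rV.
rewrite ge0_integral_rV_cons //; last exact: mGc.
rewrite ge0_integral_rV_cons //.
have mGx x : measurable_fun setT (fun v : 'rV[R]_n => G (cons_rV (x, v))).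
  by apply: measurableT_comp => //; exact: measurable_cons_rVr.
under eq_integral => x _.
  under eq_integral do rewrite scale_cons_rV.
  rewrite (IHn (fun v : 'rV[R]_n => G (cons_rV (c * x, v)))) //.
  over.
have mI : measurable_fun setT
    (fun x => \int[@lebesgue_rV R n]_v G (cons_rV (x, v)))%E.
  apply: (measurable_fun_fubini_tonelli_F (fun p => G (cons_rV p))) => //.
  by apply: measurableT_comp => //; exact: measurable_cons_rV.
have I0 x : (0 <= \int[@lebesgue_rV R n]_v G (cons_rV (x, v)))%E.
  exact: integral_ge0.
have V0 : 0 <= c^-1 by rewrite invr_ge0 ltW.
have mIc : measurable_fun setT
    (fun x : R => \int[@lebesgue_rV R n]_v G (cons_rV (c * x, v)%R))%E.
  by apply: (measurableT_comp mI); exact: mulrl_measurable.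
rewrite (ge0_integralZl lebesgue_measure measurableT mIc
  (fun x _ => I0 (c * x))); last by rewrite lee_fin exprn_ge0.
by rewrite (ge0_integral_scale1 _ _ _ c0 mI I0) muleA -EFinM exprSr.
Qed.

Lemma integral_rV_scale (R : realType) n (c : R) (G : 'rV[R]_n -> \bar R) :
  0 < c -> (@lebesgue_rV R n).-integrable setT G ->
  (\int[@lebesgue_rV R n]_v G (c *: v) =
   (c^-1 ^+ n)%:E * \int[@lebesgue_rV R n]_v G v)%E.
Proof.
move=> c0 iG; have mG := measurable_int _ iG; rewrite integralE [in RHS]integralE.
rewrite muleBr //; last exact: integrable_add_def.
have Ep := ge0_integral_rV_scale _ _ _ _ c0 (measurable_funepos mG) (funepos_ge0 G).
have En := ge0_integral_rV_scale _ _ _ _ c0 (measurable_funeneg mG) (funeneg_ge0 G).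
rewrite -Ep -En; congr (_ - _)%E; apply: eq_integral => v _.
- by rewrite !funeposE.
- by rewrite !funenegE.
Qed.

(** * The Euclidean norm and a radial integrable majorant *)

Lemma measurable_dot (R : realType) n (x : 'rV[R]_n) :
  measurable_fun setT (fun v : 'rV[R]_n => dot x v).
Proof.
rewrite /dot; apply: measurable_sum => i; apply: measurable_funM => //.
exact: measurable_rV_coord.
Qed.

Lemma measurable_enorm (R : realType) n :
  measurable_fun setT (fun v : 'rV[R]_n => enorm v).
Proof.
apply: (measurableT_comp (continuous_measurable_fun (@sqrt_continuous R))).
rewrite /dot; apply: measurable_sum => i.
by apply: measurable_funM; exact: measurable_rV_coord.
Qed.

Lemma enorm_ge0 (R : realType) n (v : 'rV[R]_n) : 0 <= enorm v.
Proof. exact: sqrtr_ge0. Qed.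

Lemma enormZ (R : realType) n (c : R) (v : 'rV[R]_n) : 0 <= c ->
  enorm (c *: v) = c * enorm v.
Proof.
move=> c0; rewrite /enorm -[in RHS](ger0_norm c0) -sqrtr_sqr -sqrtrM ?sqr_ge0 //.
congr Num.sqrt; rewrite /dot mulr_sumr; apply: eq_bigr => i _.
by rewrite !mxE; ring.
Qed.

Lemma dotZr (R : realType) n (c : R) (v w : 'rV[R]_n) :
  dot v (c *: w) = c * dot v w.
Proof.
by rewrite /dot mulr_sumr; apply: eq_bigr => i _; rewrite !mxE mulrCA.
Qed.

Lemma dotZl (R : realType) n (c : R) (v w : 'rV[R]_n) :
  dot (c *: v) w = c * dot v w.
Proof. by rewrite /dot mulr_sumr; apply: eq_bigr => i _; rewrite !mxE mulrA. Qed.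

Lemma normr_coord_le_enorm (R : realType) n (v : 'rV[R]_n) i :
  `|v ord0 i| <= enorm v.
Proof.
rewrite -sqrtr_sqr ler_sqrt; last by apply: sumr_ge0 => j _; exact: sqr_ge0.
rewrite /dot (bigD1 i) //= -expr2 lerDl sumr_ge0 // => j _; exact: sqr_ge0.
Qed.

Lemma powR_nincr (R : realType) (c x y : R) : c <= 0 -> 0 < x -> x <= y ->
  y `^ c <= x `^ c.
Proof.
move=> c0 x0 xy; rewrite -[c]opprK !(powRN _ (- c)) lef_pV2 ?posrE ?powR_gt0 //.
  by apply: ge0_ler_powR; rewrite ?oppr_ge0 ?nnegrE // ltW // (lt_le_trans x0).
exact: lt_le_trans xy.
Qed.

Lemma power_profile_nincr (R : realType) (a b x y : R) : a <= 1 -> - 1 <= b ->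
  0 < x -> x <= y -> power_profile a b y <= power_profile a b x.
Proof.
move=> a1 b1 x0 xy; rewrite /power_profile le_min !ge_min.
by rewrite !powR_nincr ?orbT //; lra.
Qed.

(** A coordinate hyperplane is a box with one side [[set 0]]. Its measure is a product with a zero
    factor, which absorbs the infinite lengths of the other sides. *)
Lemma ae_coord_neq0 (R : realType) n :
  {ae @lebesgue_rV R n, forall v : 'rV[R]_n, forall i, v ord0 i != 0}.
Proof.
apply: filter_forall => i.
pose A (j : 'I_n) : set R := if j == i then [set 0] else setT.
have mA j : measurable (A j).
  by rewrite /A; case: ifP => _; [exact: measurable_set1|exact: measurableT].
exists [set v : 'rV[R]_n | forall j, A j (v ord0 j)]; split.
- exact: measurable_box_rV.
- apply: etrans (lebesgue_rV_box mA) _.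
  by rewrite (bigD1 i) //= /A eqxx lebesgue_measure_set1 mul0e.
- move=> v /= /negP; rewrite negbK => /eqP vi j; rewrite /A.
  by case: ifP => // /eqP ->.
Qed.

(** The bound [a <= 1] makes the profile decreasing, so each of the [n] factors is at most the
    profile at one coordinate. The resulting product integrates coordinate by coordinate. *)
Lemma integrable_power_profile_enorm (R : realType) n (a b : R) :
  0 < a <= 1 -> 0 < b ->
  (@lebesgue_rV R n).-integrable setT
    (fun v => (power_profile a b (enorm v) ^+ n)%:E).
Proof.
move=> /andP[a0 a1] b0.
have mL : measurable_fun setT
    (fun v : 'rV[R]_n => (power_profile a b (enorm v) ^+ n)%:E).
  apply/measurable_EFinP; apply: measurable_funX.
  apply: measurableT_comp; [exact: measurable_power_profile|exact: measurable_enorm].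
have p0 := power_profile_ge0 _ a b.
apply/integrableP; split => //.
under eq_integral do rewrite gee0_abs ?lee_fin ?exprn_ge0 //.
have mf : measurable_fun [set: R] (fun x => power_profile a b `|x|).
  by apply: measurableT_comp => //; exact: measurable_power_profile.
apply: (@le_lt_trans _ _ (\int[@lebesgue_rV R n]_v
   (\prod_(i < n) power_profile a b `|v ord0 i|)%:E)%E).
  (* Only almost everywhere: power_profile a b 0 is the junk value 0. *)
  apply: ae_ge0_le_integral => //.
  - by move=> v _; rewrite lee_fin exprn_ge0.
  - by move=> v _; rewrite lee_fin; apply: prodr_ge0.
  - apply/measurable_EFinP; apply: measurable_prod => i _.
    by apply: (measurableT_comp mf); exact: measurable_rV_coord.
  apply: filterS (ae_coord_neq0 R n) => v v0 _; rewrite lee_fin.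
  rewrite -[X in _ ^+ X]card_ord -prodr_const; apply: ler_prod => i _.
  rewrite p0 /=; apply: power_profile_nincr => //.
  - lra.
  - by rewrite normr_gt0.
  - exact: normr_coord_le_enorm.
rewrite (ge0_integral_rV_prod _ _ _ mf) // ltey_eq prode_fin_num // => i _.
rewrite ge0_fin_numE ?integral_power_profile_lty //.
by apply: integral_ge0 => x _; rewrite lee_fin.
Qed.

(** * Fubini for dominated real integrands *)

(** A majorant depending on [y] alone, together with the finite measure of [D], makes the integrand
    integrable for the product measure. Integrability of the inner integral is returned too, since
    linearity of the spectral integrals rests on it. *)
Lemma Rintegral_swap d1 d2 (T1 : measurableType d1) (T2 : measurableType d2)
    (R : realType) (m1 : {sigma_finite_measure set T1 -> \bar R})
    (m2 : {sigma_finite_measure set T2 -> \bar R}) (D : set T1)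
    (f : T1 * T2 -> R) (h : T2 -> R) :
  measurable D -> (m1 D < +oo)%E -> measurable_fun setT f ->
  m2.-integrable setT (EFin \o h) ->
  (forall x y, D x -> `|f (x, y)| <= h y) ->
  m2.-integrable setT (fun y => (Rintegral m1 D (fun x => f (x, y)))%:E) /\
  Rintegral m1 D (fun x => Rintegral m2 setT (fun y => f (x, y))) =
  Rintegral m2 setT (fun y => Rintegral m1 D (fun x => f (x, y))).
Proof.
move=> mD Dfin mf ih fh.
(* The indicator moves the restriction to [D] into the integrand, so that Fubini applies on the full
   product space. *)
pose F (p : T1 * T2) : \bar R := (\1_D p.1 * f p)%:E.
have mF : measurable_fun setT F.
  apply/measurable_EFinP; apply: measurable_funM => //.
  by apply: measurableT_comp => //; exact: measurable_indic.
have mh : measurable_fun setT h by apply/measurable_EFinP; exact: measurable_int ih.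
have FE x y : D x -> F (x, y) = (f (x, y))%:E.
  by move=> Dx; rewrite /F /= indicE mem_set // mul1r.
have F0 x y : ~ D x -> F (x, y) = 0%E.
  by move=> Dx; rewrite /F /= indicE memNset // mul0r.
have mF2 y : measurable_fun setT (fun x => F (x, y)).
  by apply: (measurableT_comp mF); exact: pair2_measurable.
have Fh y : (\int[m1]_x `|F (x, y)| <= m1 D * `|(h y)%:E|)%E.
  rewrite [leRHS]muleC -integral_cst // [leRHS]integral_mkcond.
  apply: ge0_le_integral => //.
  - exact: measurableT_comp.
  - by apply/(measurable_restrictT _ mD).
  move=> x _; rewrite patchE; case: ifPn => [/set_mem Dx|/negP xD].
    by rewrite FE // !abse_EFin lee_fin (le_trans (fh _ _ Dx)) // ler_norm.
  by rewrite F0 ?abse0 // => Dx; apply: xD; exact: mem_set.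
have ih' : m2.-integrable setT (fun y => m1 D * `|(h y)%:E|)%E.
  rewrite -[m1 D]fineK ?ge0_fin_numE //; apply: integrableZl => //.
  exact: integrable_abse.
have iF : (m1 \x m2)%E.-integrable setT F.
  apply/(integrable21ltyP _ _ mF).
  apply: le_lt_trans (integrable_lty _ ih') => //.
  apply: ge0_le_integral => //.
  - by move=> y _; apply: integral_ge0.
  - apply: (measurable_fun_fubini_tonelli_G (abse \o F)) => //.
      exact: measurableT_comp.
    by move=> p; exact: abse_ge0.
  - exact: measurable_int ih'.
(* [Rintegral] is [fine] of an extended integral; identifying the two takes finiteness, here from a
   bounded function on a set of finite measure. *)
have E2 y : (Rintegral m1 D (fun x => f (x, y)))%:E = (\int[m1]_x F (x, y))%E.
  have -> : (\int[m1]_x F (x, y) = \int[m1]_(x in D) (f (x, y))%:E)%E.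
    rewrite [RHS]integral_mkcond; apply: eq_integral => x _.
    rewrite patchE; case: ifPn => [/set_mem/FE //|/negP xD].
    by rewrite F0 // => Dx; apply: xD; exact: mem_set.
  rewrite /Rintegral fineK //; apply: integrable_fin_num => //.
  apply: (@le_integrable _ _ _ _ _ mD _ (cst (h y)%:E)).
  - apply/measurable_EFinP; apply: measurable_funTS.
    by apply: (measurableT_comp mf); exact: pair2_measurable.
  - move=> x Dx; rewrite !abse_EFin lee_fin.
    by rewrite (le_trans (fh _ _ Dx)) // ler_norm.
  - apply/integrableP; split => //; rewrite /= integral_cst //.
    by rewrite lte_mul_pinfty // ltry.
have E1 x : D x -> (Rintegral m2 setT (fun y => f (x, y)))%:E = (\int[m2]_y F (x, y))%E.
  move=> Dx; rewrite /Rintegral fineK; last first.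
    apply: integrable_fin_num => //; apply: le_integrable ih => //.
    - apply/measurable_EFinP.
      by apply: (measurableT_comp mf); exact: pair1_measurable.
    - move=> y _; rewrite !abse_EFin lee_fin.
      by rewrite (le_trans (fh _ _ Dx)) // ler_norm.
  by apply: eq_integral => y _; rewrite FE.
split.
  under eq_fun do rewrite E2.
  apply: le_integrable ih' => //; first exact: measurable_fubini_G iF.
  move=> y _; apply: (le_trans (le_abse_integral _ _ _)) => //.
  by rewrite (le_trans (Fh y)) // lee_abs.
rewrite [LHS]/Rintegral [RHS]/Rintegral; congr fine.
under [RHS]eq_integral do rewrite E2.
rewrite -Fubini // integral_mkcond; apply: eq_integral => x _.
rewrite patchE; case: ifPn => [/set_mem/E1 //|/negP xD].
rewrite integral0_eq // => y _; rewrite F0 // => Dx.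
by apply: xD; exact: mem_set.
Qed.

(** * The time integral and the spectral form of the covariance *)

Lemma normr_sin_le (R : realType) (x : R) : `|sin x| <= `|x|.
Proof.
wlog x0 : x / 0 < x.
  move=> H; have [x0|x0|->] := ltgtP x 0; last by rewrite sin0.
  - by rewrite -normrN -sinN -[leRHS]normrN; apply: H; rewrite oppr_gt0.
  - exact: H.
have [c _] := @MVT R sin cos 0 x x0 (fun x _ => is_derive_sin x)
  (continuous_subspaceT (@continuous_sin R)).
rewrite sin0 !subr0 => ->.
by rewrite normrM ler_piMl // cos_max.
Qed.

Lemma continuous_sin_affine_sqr (R : realType) (t q : R) :
  continuous (fun r : R => sin ((t - r) * q) ^+ 2).
Proof.
move=> x; have cs : {for x, continuous (fun r : R => sin ((t - r) * q))}.
  apply: continuous_comp; last exact: continuous_sin.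
  apply: continuousM; last exact: cst_continuous.
  by apply: continuousB; [exact: cst_continuous|exact: cvg_id].
exact: (continuousM cs cs).
Qed.

Lemma Rintegral_sin_sqr (R : realType) (t q : R) : 0 < t ->
  Rintegral lebesgue_measure `[0, t] (fun r => sin ((t - r) * q) ^+ 2) =
  t / 2 * (1 - sinc (2 * t * q)).
Proof.
move=> t0; have [->|q0] := eqVneq q 0.
  rewrite mulr0 /sinc eqxx subrr mulr0.
  under eq_Rintegral do rewrite mulr0 sin0 expr0n.
  by rewrite Rintegral_cst //= mul0r.
(* Antiderivative coming from [sin^2 y = (1 - cos (2 y)) / 2] with [y = (t - r) q]. *)
pose F (r : R) : R := r / 2 + (4 * q)^-1 * sin (2 * ((t - r) * q)).
have dF (r : R) : is_derive r (1 : R) F (sin ((t - r) * q) ^+ 2 : R).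
  pose g (r : R) : R := 2 * q * t - 2 * q * r.
  have dg : is_derive r (1 : R) g (- (2 * q)).
    have D := is_deriveB (is_derive_cst (2 * q * t : R) r (1 : R))
      (is_deriveZ (2 * q) (is_derive_id r (1 : R))).
    by apply: (is_derive_eq D); rewrite /GRing.scale /= mulr1 sub0r.
  have ds := is_derive1_comp (is_derive_sin (g r)) dg.
  have D := is_deriveD (is_deriveZ 2^-1 (is_derive_id r (1 : R)))
    (is_deriveZ (4 * q)^-1 ds).
  have E : F = (2^-1 \*: id + (4 * q)^-1 \*: (sin \o g)).
    apply/funext => y; rewrite /F /g /= /GRing.scale /=.
    by congr (_ + _ * sin _); [exact: mulrC|ring].
  rewrite E; apply: (is_derive_eq D).
  rewrite /GRing.scale /= mulr1.
  have -> : g r = ((t - r) * q) *+ 2 by rewrite /g; ring.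
  rewrite cos_mulr2n sin2cos2.
  by field; rewrite q0.
have cF x : {for x, continuous F}.
  by have [/derivable1_diffP + _] := dF x; exact: differentiable_continuous.
rewrite /Rintegral (continuous_FTC2 (F := F)) //.
- rewrite /= /F subrr mul0r mulr0 sin0 subr0 mul0r add0r mulr0 addr0.
  have n0 : 2 * t * q != 0 by rewrite !mulf_neq0 // gt_eqF.
  rewrite /sinc (negPf n0) mulrA.
  by field; rewrite q0 gt_eqF.
- exact/continuous_subspaceT/continuous_sin_affine_sqr.
- split.
  + by move=> x _; have [] := dF x.
  + exact/cvg_at_right_filter/cF.
  + exact/cvg_at_left_filter/cF.
- by move=> r _; rewrite derive1E; have [_ ->] := dF r.
Qed.

(** The spatial spectral density of the field at time [t], up to the factor [(2 pi)^-d]: the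
    integral of [wave_kernel] over [r] in [[0, t]]. *)
Definition wave_spectrum {R : realType} {d} (beta theta t : R) (xi : 'rV[R]_d) : R :=
  t / (2 * theta) * (1 - sinc (2 * t * Num.sqrt theta * enorm xi)) *
  enorm xi `^ (beta - d%:R - 2).

(** The integrand of [wave_cov] at equal times, without its phase [expi]. *)
Definition wave_kernel {R : realType} {d} (beta theta t : R) (r : R)
    (xi : 'rV[R]_d) : R :=
  (sin ((t - r) * Num.sqrt theta * enorm xi) / (Num.sqrt theta * enorm xi)) ^+ 2 *
  enorm xi `^ (beta - d%:R).

Lemma wave_kernel_ge0 (R : realType) d (beta theta t r : R) (xi : 'rV[R]_d) :
  0 <= wave_kernel beta theta t r xi.
Proof. by rewrite mulr_ge0 ?sqr_ge0 ?powR_ge0. Qed.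

(** With [q = sqrt theta * |xi|], the factor [1 / q^2] yields the division by [theta] and lowers the
    exponent by 2. The constant [c] stands for the value at [xi] of a weight independent of time. *)
Lemma Rintegral_wave_kernel (R : realType) d (beta theta t c : R) (xi : 'rV[R]_d) :
  0 < theta -> 0 < t ->
  Rintegral lebesgue_measure `[0, t]
    (fun r => c * wave_kernel beta theta t r xi) =
  c * wave_spectrum beta theta t xi.
Proof.
move=> th0 t0; set q := Num.sqrt theta * enorm xi.
(* At [xi = 0] both sides vanish: the left because the inverse of 0 is 0, the right because
   [sinc 0 = 1]. *)
have [x0|x0] := eqVneq (enorm xi) 0.
  rewrite /wave_spectrum x0 mulr0 /sinc eqxx subrr mulr0 mul0r mulr0.
  under eq_Rintegral do
    rewrite /wave_kernel x0 !mulr0 invr0 mulr0 expr0n mul0r mulr0.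
  by rewrite Rintegral_cst //= mul0r.
have xp : 0 < enorm xi by rewrite lt_neqAle eq_sym x0 enorm_ge0.
have sp : 0 < Num.sqrt theta by rewrite sqrtr_gt0.
have kE r : c * wave_kernel beta theta t r xi =
    c * enorm xi `^ (beta - d%:R) / q ^+ 2 * sin ((t - r) * q) ^+ 2.
  have -> : (t - r) * q = (t - r) * Num.sqrt theta * enorm xi by rewrite /q mulrA.
  by rewrite /wave_kernel expr_div_n -/q; ring.
under eq_Rintegral do rewrite kE.
rewrite RintegralZl //; last first.
  apply: continuous_compact_integrable; first exact: segment_compact.
  exact/continuous_subspaceT/continuous_sin_affine_sqr.
have p2 : enorm xi `^ 2 = enorm xi ^+ 2 by rewrite -powR_mulrn // enorm_ge0.
rewrite Rintegral_sin_sqr // /wave_spectrum.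
rewrite (@powRB _ _ (beta - d%:R) 2); last by rewrite x0 implybT.
rewrite p2 [q ^+ 2]exprMn sqr_sqrtr ?ltW // -/q -[2 * t * _ * enorm xi]mulrA -/q.
by field; rewrite x0 gt_eqF.
Qed.

(** Two bounds on the squared quotient, uniform in [r]: [|sin y| <= |y|] gives [t^2], and
    [|sin y| <= 1] gives [1 / (theta |xi|^2)]. Each is used where the matching power attains the
    minimum in the profile. *)
Lemma wave_kernel_le (R : realType) d (beta theta t r : R) (xi : 'rV[R]_d) :
  (0 < d)%N -> 0 < theta -> 0 <= r <= t ->
  wave_kernel beta theta t r xi <= Num.max (t ^+ 2) theta^-1 *
    power_profile (beta / d%:R) ((2 - beta) / d%:R) (enorm xi) ^+ d.
Proof.
move=> d0 th0 /andP[r0 rt].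
have dn : d%:R != 0 :> R by rewrite pnatr_eq0 -lt0n.
have m0 : 0 <= Num.max (t ^+ 2) theta^-1 by rewrite le_max sqr_ge0.
have [x0|x0] := eqVneq (enorm xi) 0.
  rewrite /wave_kernel x0 !mulr0 invr0 mulr0 expr0n mul0r mulr_ge0 //.
  by rewrite exprn_ge0 // power_profile_ge0.
have xp : 0 < enorm xi by rewrite lt_neqAle eq_sym x0 enorm_ge0.
have sp : 0 < Num.sqrt theta by rewrite sqrtr_gt0.
have pE c : (enorm xi `^ c) ^+ d = enorm xi `^ (c * d%:R).
  by rewrite powRrM powR_mulrn ?powR_ge0.
rewrite /power_profile minEle; case: ifP => _; rewrite pE /wave_kernel.
- have -> : (beta / d%:R - 1) * d%:R = beta - d%:R by field.
  apply: ler_wpM2r; first exact: powR_ge0.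
  rewrite le_max; apply/orP; left.
  rewrite -[leLHS]real_normK ?num_real // lerXn2r ?nnegrE ?normr_ge0 //; first lra.
  rewrite normrM normfV ler_pdivrMr; last by rewrite normr_gt0 mulf_neq0 ?gt_eqF.
  rewrite -mulrA (le_trans (normr_sin_le _ _)) // normrM ler_wpM2r //.
  by rewrite ger0_norm; lra.
- have -> : (- ((2 - beta) / d%:R) - 1) * d%:R = beta - d%:R - 2 by field.
  rewrite (@powRB _ _ (beta - d%:R) 2); last by rewrite x0 implybT.
  have -> : enorm xi `^ 2 = enorm xi ^+ 2 by rewrite -powR_mulrn // enorm_ge0.
  rewrite mulrCA [leLHS]mulrC; apply: ler_wpM2l; first exact: powR_ge0.
  rewrite expr_div_n exprMn sqr_sqrtr ?(ltW th0) // invfM mulrA.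
  apply: ler_wpM2r; first by rewrite invr_ge0 sqr_ge0.
  rewrite le_max; apply/orP; right.
  by rewrite ler_piMl ?invr_ge0 ?(ltW th0) //.
Qed.

Lemma measurable_wave_kernel (R : realType) d (beta theta t : R) :
  measurable_fun setT
    (fun p : R * 'rV[R]_d => wave_kernel beta theta t p.1 p.2).
Proof.
have mn : measurable_fun setT (fun p : R * 'rV[R]_d => enorm p.2).
  by apply: measurableT_comp => //; exact: measurable_enorm.
have ms : measurable_fun [set: R] (@sin R).
  by apply: continuous_measurable_fun; exact: continuous_sin.
apply: measurable_funM; last first.
  exact: (measurableT_comp (@measurable_powR R (beta - d%:R)) mn).
apply: measurable_funX; apply: measurable_funM.
  apply: (measurableT_comp ms); apply: measurable_funM mn.
  apply: measurable_funM => //; exact: measurable_funB.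
(* On nonnegative reals inversion is the power [-1], also at 0, so its measurability is that of
   [powR]. *)
have -> : (fun p : R * 'rV[R]_d => (Num.sqrt theta * enorm p.2)^-1) =
    (fun p => (Num.sqrt theta * enorm p.2) `^ (-1)).
  by apply/funext => p; rewrite powR_inv1 // mulr_ge0 ?sqrtr_ge0 ?enorm_ge0.
apply: (measurableT_comp (@measurable_powR R (-1))).
exact: measurable_funM.
Qed.

(** Here the range of [beta] enters: [0 < beta] gives integrability at 0, [beta < 2] at infinity,
    and [beta < d] makes the profile decreasing. The weight [w] will be a product of trigonometric
    functions. *)
Lemma wave_kernel_swap (R : realType) d (beta theta t : R) (w : 'rV[R]_d -> R) :
  0 < beta < Num.min 2 d%:R -> 0 < theta -> 0 < t ->
  measurable_fun setT w -> (forall xi, `|w xi| <= 1) ->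
  (@lebesgue_rV R d).-integrable setT
    (fun xi => (w xi * wave_spectrum beta theta t xi)%:E) /\
  Rintegral lebesgue_measure `[0, t] (fun r : R => Rintegral (@lebesgue_rV R d)
    setT (fun xi => w xi * wave_kernel beta theta t r xi)) =
  Rintegral (@lebesgue_rV R d) setT
    (fun xi => w xi * wave_spectrum beta theta t xi).
Proof.
rewrite lt_min => /and3P[b0 b2 bd] th0 t0 mw w1.
have d0 : (0 < d)%N by rewrite -(ltr_nat R) (lt_trans b0).
have dp : 0 < d%:R :> R by rewrite ltr0n.
pose a := beta / d%:R; pose b := (2 - beta) / d%:R.
have a01 : 0 < a <= 1 by rewrite divr_gt0 //= ler_pdivrMr ?mul1r // ltW.
have bp : 0 < b by rewrite divr_gt0 // subr_gt0.
pose C := Num.max (t ^+ 2) theta^-1.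
have iC : (@lebesgue_rV R d).-integrable setT
    (EFin \o (fun xi => C * power_profile a b (enorm xi) ^+ d)).
  exact: (integrableZl measurableT C
    (integrable_power_profile_enorm _ _ _ _ a01 bp)).
pose f (p : R * 'rV[R]_d) := w p.2 * wave_kernel beta theta t p.1 p.2.
have mf : measurable_fun setT f.
  apply: measurable_funM; last exact: measurable_wave_kernel.
  exact: measurableT_comp.
have fC r xi : r \in `[0, t] -> `|f (r, xi)| <= C * power_profile a b (enorm xi) ^+ d.
  rewrite in_itv /= => rt; rewrite normrM /=.
  apply: le_trans (wave_kernel_le _ _ _ _ _ _ _ d0 th0 rt).
  by rewrite [X in _ * X]ger0_norm ?wave_kernel_ge0 // ler_piMl ?wave_kernel_ge0.
have E xi : Rintegral lebesgue_measure `[0, t]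
    (fun r => w xi * wave_kernel beta theta t r xi) =
    w xi * wave_spectrum beta theta t xi.
  exact: Rintegral_wave_kernel.
have fin : (lebesgue_measure (`[0%R, t]%classic : set (measurableTypeR R)) < +oo)%E.
  by rewrite lebesgue_measure_itv /= lte_fin t0 ltry.
have := @Rintegral_swap _ _ (measurableTypeR R) 'rV[R]_d R lebesgue_measure
  (@lebesgue_rV R d) (`[0, t]%classic : set (measurableTypeR R)) f _
  (measurable_itv _) fin mf iC fC.
rewrite /f /=.
under [in X in X /\ _]eq_fun do rewrite E.
under [in X in _ /\ _ = X]eq_Rintegral do rewrite E.
done.
Qed.

(** Taking real parts turns the phase into a cosine, every other factor being real. *)
Lemma wave_cov_spectral (R : realType) d (beta theta t c : R) (x y : 'rV[R]_d) :
  0 < beta < Num.min 2 d%:R -> 0 < theta -> 0 < t ->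
  (c%:C)%C = wave_cov beta theta t x t y ->
  c = ((2 * pi) ^+ d)^-1 * Rintegral (@lebesgue_rV R d) setT
    (fun xi => cos (dot (x - y) xi) * wave_spectrum beta theta t xi).
Proof.
move=> hb th0 t0 /(congr1 (@complex.Re R)) /=.
rewrite /wave_cov /Cintegral minxx /= mul0r subr0 => ->.
congr (_ * _).
have [//|//|_ <-] := wave_kernel_swap _ _ _ _ _ (fun xi => cos (dot (x - y) xi))
  hb th0 t0.
- apply: measurableT_comp; last exact: measurable_dot.
  by apply: continuous_measurable_fun; exact: continuous_cos.
- by move=> xi; exact: cos_max.
apply: eq_Rintegral => r _; apply: eq_Rintegral => xi _.
rewrite /= !mulr0 !subr0 /wave_kernel expr2.
by rewrite !mulrA.
Qed.

Lemma integrable_rV_scale (R : realType) n (c : R) (G : 'rV[R]_n -> \bar R) :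
  0 < c -> (@lebesgue_rV R n).-integrable setT G ->
  (@lebesgue_rV R n).-integrable setT (fun v => G (c *: v)).
Proof.
move=> c0 /integrableP[mG Goo]; apply/integrableP; split.
  by apply: measurableT_comp => //; exact: measurable_scale_rV.
have mA : measurable_fun setT (abse \o G) by exact: measurableT_comp.
have := ge0_integral_rV_scale _ _ _ _ c0 mA (fun v => abse_ge0 (G v)).
move=> /= ->; rewrite lte_mul_pinfty // lee_fin exprn_ge0 // invr_ge0.
exact: ltW.
Qed.

(** * Square integrability and covariances of second differences *)

Lemma Lfun2_of_integral_sqr d (T : measurableType d) (R : realType)
    (mu : {measure set T -> \bar R}) (X : T -> R) :
  measurable_fun setT X -> (\int[mu]_w (X w * X w)%:E < +oo)%E ->
  X \in Lfun mu 2%:E.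
Proof.
move=> mX Xoo; rewrite inE; apply/andP; split; rewrite inE //=.
rewrite /finite_norm unlock poweR_lty //.
apply: le_lt_trans Xoo; rewrite le_eqVlt; apply/orP; left; apply/eqP.
apply: eq_integral => w _; rewrite abse_EFin poweR_EFin powR_mulrn //.
by rewrite real_normK ?num_real.
Qed.

Lemma second_differenceE (T : Type) (R : realType) (X Y Z : T -> R) :
  (fun w => X w + Y w - 2 * Z w) = (X \+ Y) \- 2 \o* Z.
Proof. by apply/funext => w /=; rewrite [2 * _]mulrC. Qed.

Lemma Lfun_second_difference d (T : measurableType d) (R : realType)
    (P : probability T R) (X Y Z : T -> R) :
  X \in Lfun P 2%:E -> Y \in Lfun P 2%:E -> Z \in Lfun P 2%:E ->
  (fun w => X w + Y w - 2 * Z w) \in Lfun P 2%:E.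
Proof.
move=> X2 Y2 Z2; rewrite second_differenceE.
rewrite rpredB ?lee1n // => p; first by rewrite rpredD.
by apply: Lfun_scale => //; rewrite ler1n.
Qed.

Lemma covariance_second_differencel d (T : measurableType d) (R : realType)
    (P : probability T R) (X Y Z W : T -> R) :
  X \in Lfun P 2%:E -> Y \in Lfun P 2%:E -> Z \in Lfun P 2%:E ->
  W \in Lfun P 2%:E ->
  covariance P (fun w => X w + Y w - 2 * Z w) W =
  (covariance P X W + covariance P Y W - 2%:E * covariance P Z W)%E.
Proof.
move=> X2 Y2 Z2 W2; rewrite second_differenceE.
have sub := Lfun_subset12 (fin_num_measure P _ measurableT).
rewrite covarianceBl ?covarianceDl ?covarianceZl //.
- exact: sub.
- exact: sub.
- exact: Lfun2_mul_Lfun1.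
- by rewrite rpredD ?lee1n.
- by apply: Lfun_scale => //; rewrite ler1n.
Qed.

Lemma EFin_second_difference (R : realType) (c x y z : R) :
  ((c * x)%:E + (c * y)%:E - 2%:E * (c * z)%:E = (c * (x + y - 2 * z))%:E)%E.
Proof. by rewrite -[LHS]/(c * x + c * y - 2 * (c * z))%:E; congr EFin; ring. Qed.

(** * Second differences and scaling under the spectral integral *)

(** For a cosine weight this is a covariance of the field up to [(2 pi)^-d]. General weights are
    allowed because each second difference multiplies the cosine by a squared sine. *)
Definition spectral_integral {R : realType} {d} (beta theta t : R)
    (w : 'rV[R]_d -> R) : R :=
  Rintegral (@lebesgue_rV R d) setT (fun xi => w xi * wave_spectrum beta theta t xi).

(** Linearity, each term being integrable by [wave_kernel_swap]. The factor [c], later [-4], stays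
    outside [w] so that the weight remains bounded by 1. *)
Lemma spectral_integral_second_difference (R : realType) d (beta theta t c : R)
    (w1 w2 w3 w : 'rV[R]_d -> R) :
  0 < beta < Num.min 2 d%:R -> 0 < theta -> 0 < t ->
  measurable_fun setT w1 -> measurable_fun setT w2 -> measurable_fun setT w3 ->
  measurable_fun setT w ->
  (forall xi, `|w1 xi| <= 1) -> (forall xi, `|w2 xi| <= 1) ->
  (forall xi, `|w3 xi| <= 1) -> (forall xi, `|w xi| <= 1) ->
  (forall xi, w1 xi + w2 xi - 2 * w3 xi = c * w xi) ->
  spectral_integral beta theta t w1 + spectral_integral beta theta t w2 -
    2 * spectral_integral beta theta t w3 = c * spectral_integral beta theta t w.
Proof.
move=> hb th0 t0 m1 m2 m3 m b1 b2 b3 b E.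
have [i1 _] := wave_kernel_swap _ _ _ _ _ _ hb th0 t0 m1 b1.
have [i2 _] := wave_kernel_swap _ _ _ _ _ _ hb th0 t0 m2 b2.
have [i3 _] := wave_kernel_swap _ _ _ _ _ _ hb th0 t0 m3 b3.
have [i _] := wave_kernel_swap _ _ _ _ _ _ hb th0 t0 m b.
have i3' := integrableZl measurableT 2 i3.
have i12 := integrableD measurableT i1 i2.
rewrite /spectral_integral -RintegralD // -!RintegralZl // -RintegralB //.
apply: eq_Rintegral => xi _.
by rewrite [RHS]mulrA -E; ring.
Qed.

Lemma dotBl (R : realType) n (v w z : 'rV[R]_n) :
  dot (v - w) z = dot v z - dot w z.
Proof.
by rewrite /dot -sumrB; apply: eq_bigr => i _; rewrite !mxE mulrBl.
Qed.

Lemma normrM_le1 (R : realType) (x y : R) : `|x| <= 1 -> `|y| <= 1 -> `|x * y| <= 1.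
Proof. by move=> x1 y1; rewrite normrM mulr_ile1. Qed.

Lemma sin_half_sqr (R : realType) (h : R) : 2 * sin (h / 2) ^+ 2 = 1 - cos h.
Proof.
have -> : cos h = cos ((h / 2) *+ 2) by congr cos; field.
by rewrite cos_mulr2n sin2cos2; ring.
Qed.

(** The outer terms add up to [2 cos a cos h], and [1 - cos h = 2 sin^2 (h / 2)]. *)
Lemma cos_second_difference (R : realType) (a h : R) :
  cos (a + h) + cos (a - h) - 2 * cos a = - 4 * (sin (h / 2) ^+ 2 * cos a).
Proof.
rewrite cosB cosD.
have := sin_half_sqr _ h; move: (sin (h / 2) ^+ 2) => s hs.
have -> : - 4 * (s * cos a) = - 2 * (2 * s) * cos a by ring.
by rewrite hs; ring.
Qed.

(** Substitution [w = lambda xi]: the power of the norm gives [lambda ^ (beta - d - 2)], the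
    Jacobian [lambda ^ d], and [2 theta / t] undoes the prefactor of [wave_spectrum]. *)
Lemma integral_g_sp (R : realType) d (beta theta t lambda m : R) (rho : 'rV[R]_d) :
  0 < beta < Num.min 2 d%:R -> 0 < theta -> 0 < t -> 0 < lambda ->
  (\int[@lebesgue_rV R d]_(w in [set: 'rV[R]_d])
     (cos (m * dot rho w) * g_sp beta theta t lambda rho w)%:E =
   (2 * theta / t * lambda `^ (beta - 2) *
    spectral_integral beta theta t (fun xi =>
      sin (lambda * dot rho xi / 2) ^+ 4 * cos (m * (lambda * dot rho xi))))%:E)%E.
Proof.
move=> hb th0 t0 l0.
pose w xi := sin (lambda * dot rho xi / 2) ^+ 4 * cos (m * (lambda * dot rho xi)).
have mw : measurable_fun setT w.
  have md : measurable_fun setT (fun xi => lambda * dot rho xi).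
    by apply: measurable_funM => //; exact: measurable_dot.
  have ms : measurable_fun [set: R] (@sin R).
    by apply: continuous_measurable_fun; exact: continuous_sin.
  have mc : measurable_fun [set: R] (@cos R).
    by apply: continuous_measurable_fun; exact: continuous_cos.
  apply: measurable_funM; last first.
    by apply: (measurableT_comp mc); exact: measurable_funM.
  apply: measurable_funX; apply: (measurableT_comp ms); exact: measurable_funM.
have w1 xi : `|w xi| <= 1.
  apply: normrM_le1; last exact: cos_max.
  by rewrite normrX exprn_ile1 // sin_max.
have [iF _] := wave_kernel_swap _ _ _ _ _ _ hb th0 t0 mw w1.
pose F xi := (w xi * wave_spectrum beta theta t xi)%:E.
have V0 : 0 < lambda^-1 by rewrite invr_gt0.
pose K := 2 * theta / t * lambda `^ (beta - d%:R - 2).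
have E v : (cos (m * dot rho v) * g_sp beta theta t lambda rho v)%:E =
   (K%:E * F (lambda^-1 *: v))%E.
  rewrite /F /w -EFinM; congr EFin.
  rewrite dotZr mulVKf ?gt_eqF // /g_sp /wave_spectrum enormZ ?ltW //.
  rewrite powRM ?enorm_ge0 ?(ltW V0) //.
  have -> : lambda^-1 `^ (beta - d%:R - 2) = (lambda `^ (beta - d%:R - 2))^-1.
    by rewrite -powR_inv1 ?(ltW l0) // -powRrM mulN1r powRN.
  rewrite !mulrA /K.
  have : lambda `^ (beta - d%:R - 2) != 0 by rewrite gt_eqF ?powR_gt0.
  move: (lambda `^ (beta - d%:R - 2)) => L L0.
  by field; rewrite L0 !gt_eqF.
under eq_integral do rewrite E.
rewrite (integralZl measurableT (integrable_rV_scale _ _ _ _ V0 iF)).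
rewrite (integral_rV_scale _ _ _ _ V0 iF) invrK.
have -> : (\int[@lebesgue_rV R d]_v F v)%E =
    (spectral_integral beta theta t w)%:E.
  by rewrite /spectral_integral /Rintegral fineK // integrable_fin_num.
rewrite -!EFinM; congr EFin; rewrite mulrA; congr (_ * _).
have -> : lambda `^ (beta - 2) = lambda `^ (beta - d%:R - 2) * lambda ^+ d.
  rewrite -powR_mulrn ?(ltW l0) // -powRD; last by apply/implyP => _; rewrite gt_eqF.
  by congr powR; ring.
by rewrite /K mulrA.
Qed.

Theorem lemma3p2 (disp : measure_display) (T : measurableType disp)
    (R : realType) (P : probability T R) (d : nat) (beta theta : R)
    (hbeta : 0 < beta < Num.min 2 d%:R) (htheta : 0 < theta)
    (u : R -> 'rV[R]_d -> {RV P >-> R}) (hu : wave_solution beta theta u)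
    (t lambda : R) (ht : 0 < t) (hlambda : 0 < lambda) (n : nat)
    (rho : 'rV[R]_d) (hrho : enorm rho = 1)
    (k l : nat) (hk : (1 <= k <= n)%N) (hl : (1 <= l <= n)%N) :
  covariance P (sp_incr u t lambda rho k) (sp_incr u t lambda rho l) =
  ((8 * t * lambda `^ (2 - beta) / ((2 * pi) ^+ d * theta))%:E *
   \int[@lebesgue_rV R d]_(w in [set: 'rV[R]_d])
     (cos ((k%:R - l%:R) * dot rho w) *
      g_sp beta theta t lambda rho w)%:E)%E.
Proof.
have [_ mean cov] := hu.
pose x (j : nat) : 'rV[R]_d := (lambda * j%:R) *: rho.
pose kappa : R := ((2 * pi) ^+ d)^-1.
pose SI := @spectral_integral R d beta theta t.
pose cosd (v xi : 'rV[R]_d) := cos (dot v xi).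
(* The phase increment between neighbouring observation points. *)
pose h xi := lambda * dot rho xi.
pose s xi := sin (h xi / 2) ^+ 2.
have L2 y : (u t y : T -> R) \in Lfun P 2%:E.
  apply: Lfun2_of_integral_sqr; first exact: measurable_funPT.
  have [c cE _] := cov t y t y (ltW ht) (ltW ht).
  by move: cE; rewrite unlock => ->; exact: ltry.
have L1 y : (u t y : T -> R) \in Lfun P 1.
  exact: (Lfun_subset12 (fin_num_measure P _ measurableT)).
have covE a b : covariance P (u t a) (u t b) = (kappa * SI (cosd (a - b)))%:E.
  rewrite covarianceE ?Lfun2_mul_Lfun1 // !mean ?(ltW ht) // mule0 sube0.
  have [c cE /wave_cov_spectral cw] := cov t a t b (ltW ht) (ltW ht).
  by rewrite -[LHS]/('E_P[(fun w => u t a w * u t b w)%R])%E cE cw.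
have mh : measurable_fun setT h.
  by apply: measurable_funM => //; exact: measurable_dot.
have ms : measurable_fun setT s.
  apply: measurable_funX.
  apply: (measurableT_comp (continuous_measurable_fun (@continuous_sin R))).
  exact: measurable_funM.
have mcos v : measurable_fun setT (cosd v).
  apply: (measurableT_comp (continuous_measurable_fun (@continuous_cos R))).
  exact: measurable_dot.
have s1 xi : `|s xi| <= 1 by rewrite normrX exprn_ile1 // sin_max.
have cos1 v xi : `|cosd v xi| <= 1 by exact: cos_max.
have dotx j v : dot (x j) v = j%:R * h v by rewrite dotZl /h; ring.
(* The condition [1 <= j] makes [x j.-1] the true left neighbour; at [j = 0] it would be [x 0]
   again. *)
have cosx j a xi : (1 <= j)%N -> cosd (x j.+1 - a) xi + cosd (x j.-1 - a) xi -
    2 * cosd (x j - a) xi = - 4 * (s xi * cosd (x j - a) xi).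
  case: j => // j _; rewrite /cosd /s -cos_second_difference /= !dotBl !dotx.
  by congr (cos _ + cos _ - _); ring.
(* In the second argument the phase moves by [- h], which only exchanges the two outer cosines. *)
have cosx' j a xi : (1 <= j)%N -> cosd (a - x j.+1) xi + cosd (a - x j.-1) xi -
    2 * cosd (a - x j) xi = - 4 * (s xi * cosd (a - x j) xi).
  case: j => // j _; rewrite /cosd /s -cos_second_difference /= !dotBl !dotx.
  by rewrite [in RHS](addrC (cos _)); congr (cos _ + cos _ - _); ring.
have /andP[k1 _] := hk; have /andP[l1 _] := hl.
(* The second point [a] is arbitrary, so that this can be applied at the three points of the other
   increment. *)
have left a : covariance P (sp_incr u t lambda rho k) (u t a) =
    (kappa * - 4 * SI (fun xi => s xi * cosd (x k - a) xi))%:E.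
  rewrite covariance_second_differencel // !covE.
  have D : SI (cosd (x k.+1 - a)) + SI (cosd (x k.-1 - a)) -
      2 * SI (cosd (x k - a)) = - 4 * SI (fun xi => s xi * cosd (x k - a) xi).
    apply: spectral_integral_second_difference => //.
    - exact: measurable_funM.
    - by move=> xi; exact: normrM_le1.
    - by move=> xi; exact: cosx.
  by rewrite EFin_second_difference D mulrA.
have Ls := Lfun_second_difference _ _ _ _ _ _ _ (L2 (x k.+1)) (L2 (x k.-1)) (L2 (x k)).
(* Symmetry brings the increment at [l] to the left to be expanded; a second use of symmetry puts
   each term into the form of [left]. *)
rewrite covarianceC covariance_second_differencel //.
rewrite ![covariance P _ (sp_incr u t lambda rho k)]covarianceC !left.
rewrite integral_g_sp // -/(spectral_integral beta theta t _).
have -> : spectral_integral beta theta t (fun xi =>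
    sin (lambda * dot rho xi / 2) ^+ 4 *
    cos ((k%:R - l%:R) * (lambda * dot rho xi))) =
    SI (fun xi => s xi * (s xi * cosd (x k - x l) xi)).
  congr spectral_integral; apply/funext => xi.
  rewrite mulrA -expr2 -exprM; congr (_ * cos _).
  by rewrite dotBl !dotx -mulrBl.
(* The factor [s] from the first difference is independent of [l], so the second difference acts on
   the cosine alone and supplies another [-4 s]. *)
have D : SI (fun xi => s xi * cosd (x k - x l.+1) xi) +
    SI (fun xi => s xi * cosd (x k - x l.-1) xi) -
    2 * SI (fun xi => s xi * cosd (x k - x l) xi) =
    - 4 * SI (fun xi => s xi * (s xi * cosd (x k - x l) xi)).
  have sc1 v xi : `|s xi * cosd v xi| <= 1 by exact: normrM_le1.
  have msc v : measurable_fun setT (fun xi => s xi * cosd v xi).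
    exact: measurable_funM.
  apply: spectral_integral_second_difference => //.
  - exact: measurable_funM.
  - by move=> xi; exact: normrM_le1.
  - move=> xi; transitivity (s xi * (- 4 * (s xi * cosd (x k - x l) xi))).
      by rewrite -cosx' //; ring.
    by ring.
rewrite EFin_second_difference D.
(* The constants match because [(-4)^2 = (8 t / theta) * (2 theta / t)], and the two powers of
   [lambda] cancel. *)
rewrite -EFinM; congr EFin; rewrite -/SI /kappa.
have -> : lambda `^ (2 - beta) = (lambda `^ (beta - 2))^-1.
  by rewrite -powRN opprB.
have l0 : lambda `^ (beta - 2) != 0 by rewrite gt_eqF // powR_gt0.
have p0 : (2 * pi : R) ^+ d != 0 by rewrite gt_eqF // exprn_gt0 // mulr_gt0 ?pi_gt0.
move: (SI _) (lambda `^ _) ((2 * pi) ^+ d) l0 p0 => S L p l0 p0.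
by field; rewrite l0 p0 !gt_eqF.
Qed.
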